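(* There is a dense subset $X$ of $\mathbb{R}$ with $|X|=2^{\aleph_0}$, ordered by the restriction of the usual order of $\mathbb{R}$, such that $\mathrm{Emb}(X,\le)$ and $\mathrm{Epi}(X,\le)$ are trivial and every endomorphism of $(X,\le)$ is locally identity-constant.
   Context: The axiom of choice is assumed. For a chain (linearly ordered set) $(X,\le)$: an endomorphism is a map $f:X\to X$ with $x\le y\Rightarrow f(x)\le f(y)$; an epimorphism is a surjective endomorphism; an embedding is a map $f:X\to X$ with $x<y\Rightarrow f(x)<f(y)$. $\mathrm{Epi}(X,\le)$ and $\mathrm{Emb}(X,\le)$ are the monoids of all epimorphisms and all embeddings; such a monoid is trivial if its only element is the identity. For an endomorphism $f$ of $(X,\le)$ let $$C_f=\{x\in X:\ \exists a,b\in X\ (a<x<b \text{ and } f \text{ is constant on } [a,x] \text{ or on } [x,b])\},\qquad I_f=\{x\in X: f(x)=x\}.$$ $f$ is called locally identity-constant if $C_f\cup I_f$ is dense in $X$. *)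

(* Defs.v *)
From mathcomp Require Export all_boot all_order all_algebra.
From mathcomp Require Export all_classical all_reals all_analysis.
Export numFieldNormedType.Exports.

Set Implicit Arguments.
Unset Strict Implicit.
Unset Printing Implicit Defensive.

Local Open Scope classical_set_scope.
Local Open Scope order_scope.

(* A chain is a [T : orderType d]. *)

Definition is_endomorphism d (T : orderType d) (f : T -> T) : Prop :=
  {homo f : x y / x <= y}.

Definition Epi d (T : orderType d) : set (T -> T) :=
  [set f | is_endomorphism f /\ set_surj [set: T] [set: T] f].

Definition Emb d (T : orderType d) : set (T -> T) :=
  [set f | {homo f : x y / x < y}].

Arguments Epi {d} T _.
Arguments Emb {d} T _.

(* For a monoid of self-maps under composition, whose unit is [id]. *)
Definition trivial_monoid (T : Type) (M : set (T -> T)) : Prop := M = [set id].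

Definition constant_on (T U : Type) (f : T -> U) (A : set T) : Prop :=
  forall u v, A u -> A v -> f u = f v.

Definition C_ d (T : orderType d) (f : T -> T) : set T :=
  [set x | exists a b, [/\ a < x, x < b &
    constant_on f `[a, x] \/ constant_on f `[x, b]]].

Definition I_ d (T : orderType d) (f : T -> T) : set T := [set x | f x = x].

(* [order_topology T] is [T] itself, equipped with the order topology. *)
Definition locally_identity_constant d (T : orderType d) (f : T -> T) : Prop :=
  dense (C_ f `|` I_ f : set (order_topology T)).

(* A subset of a chain, as a chain under the restricted order.  The library puts
   this order on the alias [sub_type] of a subtype, not on [X] itself. *)
Definition subchain d (T : orderType d) (X : set T) : orderType d :=
  sub_type {x : T | x \in X}.

(* Main.v *)
(* Dushnik-Miller style diagonalisation.  A transfinite recursion of length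
   continuum picks points [x i] such that no [F i (x i)] is ever a point [x j],
   where [F] lists, each continuum many times, the left-continuous nondecreasing
   functions (coded by sets of pairs of rationals) taking continuum many values
   at non-fixed points; maps moving only the points of a rational interval are
   listed too, which makes the set [X] of all [x i] dense.  An endomorphism [f]
   of [X] that is not locally identity-constant is strictly increasing and has
   no fixed point on some interval, so its left limit is one of the listed
   functions; but it sends uncountably many points of [X] outside [X], whereas
   it differs from [f] at countably many points only.  An embedding is nowhere
   locally constant, so its fixed points are dense and it is the identity. *)
From Stdlib Require Import Wellfounded.
Require Import Defs.
From mathcomp Require Import wochoice lra.

Set Implicit Arguments.
Unset Strict Implicit.
Unset Printing Implicit Defensive.

Import Order.TTheory GRing.Theory Num.Theory.

Local Open Scope classical_set_scope.
Local Open Scope card_scope.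

Local Notation binseq := (nat -> bool).
Local Notation continuum_le A := ([set: binseq] #<= A).

(** * Comparison of cardinals with the continuum *)

Lemma card_leTP (T U : Type) (A : set U) :
  reflect (exists2 f : T -> U, injective f & forall x, A (f x))
          ([set: T] #<= A).
Proof.
apply: (iffP card_leP) => [[f]|[f fI fA]].
  exists (fun x => val (f (SigSub (mem_set (I : [set: T] x))))) => [x y|x].
    move=> /val_inj /(@inj _ _ _ f).
    by rewrite !in_setE => /(_ I I) [].
  exact: set_valP.
have /injfunPex[g] :
    exists2 g : T -> U, set_fun [set: T] A g & set_inj [set: T] g.
  by exists f => [x _|x y _ _ /fI].
by apply/card_leP/inj_card_le.
Qed.

Lemma binseq_pair : [set: binseq * binseq] #<= [set: binseq].
Proof.
apply/card_leTP.
exists (fun ab n => if odd n then ab.2 n./2 else ab.1 n./2) => //.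
move=> -[a b] [c d] /= E.
congr pair; apply/funext => n.
  by have /(congr1 (@^~ n.*2)) := E; rewrite odd_double doubleK.
by have /(congr1 (@^~ n.*2.+1)) := E; rewrite /= odd_double /= uphalf_double.
Qed.

Lemma binseq_prod (T U : Type) : [set: T] #<= [set: binseq] ->
  [set: U] #<= [set: binseq] -> [set: T * U] #<= [set: binseq].
Proof.
move=> /card_leTP[f fI _] /card_leTP[g gI _].
apply: card_le_trans binseq_pair; apply/card_leTP.
by exists (fun tu => (f tu.1, g tu.2)) => // -[a b] [c d] /= [/fI -> /gI ->].
Qed.

Lemma binseq_count (T : countType) : [set: T] #<= [set: binseq].
Proof.
apply/card_leTP; exists (fun t n => n == pickle t) => // t u.
move=> /(congr1 (@^~ (pickle t))).
by rewrite /= eqxx => /esym/eqP/(pcan_inj pickleK).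
Qed.

Lemma binseq_set (T : countType) : [set: set T] #<= [set: binseq].
Proof.
apply/card_leTP.
exists (fun A n => oapp (fun t => `[< A t >]) false (unpickle n)) => // A B E.
apply/funext => t; have := congr1 (@^~ (pickle t)) E.
rewrite pickleK /= => AB; apply/propext.
by split => /asboolP ABt; apply/asboolP;
  [rewrite -AB | rewrite AB].
Qed.

(** Arrange the continuum as a square. Either some row falls entirely in [A], or every row has a
    point falling in [B], and one such point per row gives continuum many. *)
Lemma continuum_le_setU (U : Type) (A B : set U) :
  continuum_le (A `|` B) -> continuum_le A \/ continuum_le B.
Proof.
move=> /card_leTP[f fI fAB]; have /card_leTP[w wI _] := binseq_pair.
have [[a aA]|noA] := pselect (exists a, forall b, A (f (w (a, b)))).
  by left; apply/card_leTP; exists (fun b => f (w (a, b))) => // b c /fI/wI [].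
right; apply/card_leTP.
have /choice[h hB] : forall a, exists b, ~ A (f (w (a, b))).
  move=> a; apply: contrapT => nb; apply: noA; exists a => b.
  by apply: contrapT => nA; apply: nb; exists b.
exists (fun a => f (w (a, h a))) => [a b /fI/wI [] //|a].
by case: (fAB (w (a, h a))) => // /hB.
Qed.

Lemma continuum_le_image (T U : Type) (f : T -> U) (A : set T) :
  continuum_le (f @` A) -> continuum_le A.
Proof. by move=> /card_le_trans; apply; exact: card_image_le. Qed.

(** * Well-orders, transfinite recursion and diagonalisation *)

(* The order is transported from a well-order of [T] to its shortest initial
   segment of full cardinality, if there is one. *)
Lemma initial_well_order (T : Type) : exists lt : T -> T -> Prop,
  [/\ well_founded lt, forall x y, x <> y -> lt x y \/ lt y x &
      forall x, ~ ([set: T] #<= [set y | lt y x])].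
Proof.
have [W Wwo] := well_ordering_principle {classic T}.
have [Wanti Wtot] : antisymmetric W /\ total W.
  have WT : wo_chain W predT by move=> A _; exact: Wwo.
  by split=> x y; [exact: (wo_chain_antisymmetric WT)|exact: (wo_chainW WT)].
pose lt (x y : T) := W x y && ((x : {classic T}) != y).
have ltmin (P : set T) : P !=set0 -> exists2 z, P z & forall y, lt y z -> ~ P y.
  move=> [z Pz].
  have [|m [[/asboolP Pm mmin] _]] := Wwo (fun z => `[< P z >]).
    by exists z; apply/asboolP.
  exists m => // y /andP[Wym ym] Py; case/eqP: ym.
  by apply: Wanti; rewrite Wym mmin//; apply/asboolP.
have ltwf : well_founded lt.
  move=> x; apply: contrapT => nx.
  have [|z nz zmin] := ltmin [set x | ~ Acc lt x]; first by exists x.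
  by apply: nz; constructor => y /zmin /contrapT.
have lttri x y : x <> y -> lt x y \/ lt y x.
  move=> xy; have /orP[Wxy|Wyx] := Wtot x y; [left|right];
    apply/andP; split => //.
    exact/eqP.
  by apply/eqP => /esym.
have lttrans x y z : lt x y -> lt y z -> lt x z.
  move=> xy yz; have [xz|/lttri[//|zx]] := pselect (x = z).
    move: xy yz; rewrite xz => /andP[Wzy /eqP zy] /andP[Wyz _].
    by case: zy; apply: Wanti; rewrite Wzy Wyz.
  (* A failure of transitivity would be a 3-cycle, which has no minimal element. *)
  exfalso; have [|m] := ltmin [set x; y; z]; first by exists x; left; left.
  by move=> [[->|->]|->] mm;
    [apply: (mm z)|apply: (mm x)|apply: (mm y)] => //=; auto.
pose big := [set x | [set: T] #<= [set y | lt y x]].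
have [[x0 Tx0]|nT] := pselect (big !=set0); last first.
  by exists lt; split => // x Tx; apply: nT; exists x.
have [|z /card_leTP[j jI jz] zmin] := ltmin big; first by exists x0.
exists (fun x y => lt (j x) (j y)); split => [|x y xy|x].
- exact: (wf_inverse_image _ _ lt j ltwf).
- by apply: lttri => /jI.
- move=> /card_leTP[k kI kx]; apply: (zmin _ (jz x)); rewrite /=.
  by apply/card_leTP; exists (j \o k) => // a b /= /jI/kI.
Qed.

(** Each value depends only on the set of earlier values, which is all that the diagonalisation has
    to avoid. *)
Lemma wf_image_recursion (I U : Type) (lt : I -> I -> Prop)
    (c : I -> set U -> U) : well_founded lt ->
  exists f : I -> U, forall i, f i = c i (f @` [set j | lt j i]).
Proof.
move=> wf; pose step i (rec : forall j, lt j i -> U) :=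
  c i [set u | exists j (h : lt j i), rec j h = u].
exists (Fix wf (fun=> U) step) => i; rewrite Fix_eq.
  congr (c i); apply/seteqP.
  split => [u [j [h <-]]|u [j h <-]]; last by exists j, h.
  by exists j.
move=> k f g fg; congr (c k); apply/seteqP.
by split => u [j [h <-]]; exists j, h; rewrite fg.
Qed.

(** Stage [i] picks a non-fixed point of [F i] that is neither an earlier point nor an earlier
    image, and whose image is not an earlier point. This settles [j = i], [j] later and [j] earlier
    alike. *)
Lemma evading_injection (I U : Type) (F : I -> U -> U) :
  [set: I] #<= [set: binseq] ->
  (forall i, continuum_le (F i @` [set r | F i r <> r])) ->
  exists2 x : I -> U, injective x & forall i j, F i (x i) <> x j.
Proof.
move=> IC FC; have [lt [wf lttri ltsmall]] := initial_well_order I.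
pose fresh i (S : set (U * U)) r := F i r <> r /\
  forall s, S s -> [/\ r <> s.1, r <> s.2 & F i r <> s.1].
have /choice[c cP] (iS : I * set (U * U)) : exists r,
    ~ continuum_le iS.2 -> fresh iS.1 iS.2 r.
  (* For a large [S] nothing is required, but choice still needs some point; [FC i] supplies one. *)
  case: iS => i S /=; have [CS|nCS] := pselect (continuum_le S).
    by have /card_leTP[f _ /(_ xpred0)[r _ _]] := FC i; exists r.
  apply: contrapT => nor.
  (* If nothing is fresh, each value of [F i] at a non-fixed point is an earlier point or the image
     of an excluded point, so [S] is large after all. *)
  have : continuum_le (fst @` S `|` F i @` (fst @` S `|` snd @` S)).
    apply: card_le_trans (FC i) _; apply: subset_card_le => _ [r Frr <-].
    apply: contrapT => /not_orP[n1 n2]; apply: nor; exists r => _.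
    split => // s Ss; split => [rs|rs|rs].
    - by apply: n2; exists r => //; left; exists s.
    - by apply: n2; exists r => //; right; exists s.
    - by apply: n1; exists s.
  move=> /continuum_le_setU[/continuum_le_image//|/continuum_le_image].
  by move=> /continuum_le_setU[|] /continuum_le_image.
have [f fE] := wf_image_recursion (fun i S => (c (i, S), F i (c (i, S)))) wf.
have f2 i : (f i).2 = F i (f i).1 by rewrite fE.
have ffresh i : fresh i (f @` [set j | lt j i]) (f i).1.
  rewrite fE /=; apply: (cP (i, _)) => /= /continuum_le_image Ci.
  by apply: (ltsmall i); exact: card_le_trans Ci.
have fpast i j : lt j i ->
    [/\ (f i).1 <> (f j).1, (f i).1 <> (f j).2 & F i (f i).1 <> (f j).1].
  by move=> ji; have [_ /(_ (f j))] := ffresh i; apply; exists j.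
exists (fun i => (f i).1) => [i j ij|i j].
  by apply: contrapT => /lttri[] /fpast[]; rewrite ij.
have [->|/lttri[ij|/fpast[]//]] := pselect (i = j).
  by have [] := ffresh j.
by have [_ + _] := fpast _ _ ij; rewrite f2 => /nesym.
Qed.

Local Open Scope ring_scope.

(** * The Cantor set and the size of real intervals *)

Section Ternary.
Variable R : realType.
Implicit Types b c : binseq.

Let e n : R := 3^-1 ^+ n.

Let s b n : R := \sum_(i < n) (b i)%:R * 2 * e i.+1.

(** The point of the Cantor set with base 3 digits 0 and 2 given by [b]. *)
Definition ternary b : R := sup (range (s b)).

Let e_gt0 n : 0 < e n. Proof. by rewrite exprn_gt0 // invr_gt0. Qed.

Let eS n : e n = 3 * e n.+1.
Proof. by rewrite /e exprS mulrA divff ?mul1r. Qed.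

Let sS b n : s b n.+1 = s b n + (b n)%:R * 2 * e n.+1.
Proof. by rewrite /s big_ord_recr. Qed.

Let s_le b n k : s b n <= s b (n + k)%N <= s b n + e n - e (n + k)%N.
Proof.
elim: k => [|k /andP[IH1 IH2]]; first by rewrite addn0 addrK lexx.
rewrite addnS sS; have := e_gt0 (n + k).+1; move: IH2; rewrite (eS (n + k)).
by case: (b _) => /= IH2 ?; apply/andP; split; lra.
Qed.

Let ternary_bound b n : s b n <= ternary b <= s b n + e n.
Proof.
have ub m : s b m <= s b n + e n.
  have [nm|/ltnW mn] := leqP n m.
    have := s_le b n (m - n); rewrite subnKC // => /andP[_].
    by have := e_gt0 m; lra.
  have := s_le b m (n - m); rewrite subnKC // => /andP[].
  by have := e_gt0 n; lra.
apply/andP; split.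
  apply: ub_le_sup; last by exists n.
  by exists (s b n + e n) => _ [m _ <-].
by apply: ge_sup => [|_ [m _ <-]//]; exists (s b 0); exists 0%N.
Qed.

Lemma ternary01 b : 0 <= ternary b <= 1.
Proof. by have := ternary_bound b 0; rewrite /s /e big_ord0 expr0 add0r. Qed.

(** At the first differing digit [n] the partial sums separate by [2 * e n.+1], while the tails
    contribute at most [e n.+1]. *)
Lemma ternary_inj : injective ternary.
Proof.
move=> b c bc; apply/funext; apply: contrapT => /existsNP[n0 /eqP n0bc].
have [n nbc nmin] := ex_minnP (ex_intro (fun n => b n != c n) n0 n0bc).
have sE : s b n = s c n.
  rewrite /s; apply: eq_bigr => i _; congr ((nat_of_bool _)%:R * _ * _).
  by apply/eqP; apply: contraT => /nmin; rewrite leqNgt ltn_ord.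
have := ternary_bound b n.+1; have := ternary_bound c n.+1; rewrite bc !sS sE.
have := e_gt0 n.+1; move: nbc.
by case: (b n) (c n) => -[]//= _ ? /andP[? ?] /andP[? ?]; lra.
Qed.

Lemma continuum_le_itvoo (x y : R) : x < y -> continuum_le `]x, y[.
Proof.
move=> xy; apply/card_leTP.
(* Squeezing [0,1] into [1/3,2/3] keeps the points off the end points of the interval. *)
exists (fun b => x + (y - x) * ((ternary b + 1) / 3)) => [b c /addrI|b].
  have yx : y - x != 0 by rewrite subr_eq0 gt_eqF.
  by move=> /(mulfI yx) H; apply: ternary_inj; lra.
rewrite /= in_itv /=; have /andP[? ?] := ternary01 b; apply/andP; split.
  by rewrite ltrDl mulr_gt0 ?subr_gt0//; lra.
by rewrite -ltrBrDl -[ltRHS]mulr1 ltr_pM2l ?subr_gt0//; lra.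
Qed.

End Ternary.

(** * Rational codes and the construction of the set *)

Lemma exists_rat_between (R : realType) (x y : R) : x < y ->
  exists2 q : rat, x < ratr q & ratr q < y.
Proof. by move=> /rat_in_itvoo[q]; rewrite in_itv => /andP[? ?]; exists q. Qed.

Lemma binseq_real (R : realType) : [set: R] #<= [set: binseq].
Proof.
apply: card_le_trans (binseq_set rat); apply/card_leTP.
exists (fun r : R => [set q : rat | ratr q < r]) => // x y xy.
wlog lxy : x y xy / x < y.
  by move=> W; have [/W->|/W->|] := ltgtP x y.
have [q xq qy] := exists_rat_between lxy.
have : [set q : rat | ratr q < y] q by [].
by rewrite -xy /= => /(lt_trans xq); rewrite ltxx.
Qed.

(* For a nondecreasing [f] on a dense set, [rho] consists of the pairs [(p, q)]
   with [q < f u] for some [u < p]; [decode rho] is then the left limit of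
   [f]. *)
Definition decode (R : realType) (rho : set (rat * rat)) (r : R) : R :=
  sup [set ratr q | q in [set q | exists2 p, ratr p < r & rho (p, q)]].

Lemma exists_evading_set (R : realType) : exists X : set R,
  [/\ forall a b, a < b -> exists2 x, X x & a < x < b,
      X #= [set: binseq] &
      forall rho,
        continuum_le (decode rho @` [set r : R | decode rho r <> r]) ->
        ~ countable [set x : R | X x /\ ~ X (decode rho x)]].
Proof.
pose good (g : R -> R) := continuum_le (g @` [set r | g r <> r]).
(* The last component repeats every function continuum many times; the first, when present, selects
   a bump instead of a decoded function. *)
pose I := (option (rat * rat) * set (rat * rat) * binseq)%type.
pose bump (p q : rat) (r : R) := if ratr p < r < ratr q then r + 1 else r.
have bump_good p q : (p < q)%O -> good (bump p q).
  move=> pq.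
  have /card_leTP[f fI fA] : continuum_le `](ratr p : R), ratr q[.
    by apply: continuum_le_itvoo; rewrite ltr_rat.
  apply/card_leTP; exists (fun c => f c + 1) => [c d /addIr/fI//|c].
  have := fA c; rewrite /= in_itv /= => fc.
  by exists (f c); rewrite /= /bump fc //; lra.
have [g0 g0good] : exists g, good g by exists (bump 0 1); apply: bump_good.
pose F0 (i : I) := if i.1.1 is Some (p, q) then bump p q else decode i.1.2.
(* Functions with too few values at non-fixed points are replaced by [g0], so that the whole list
   can be evaded. *)
pose F i := if good (F0 i) then F0 i else g0.
have FE i : good (F0 i) -> F i = F0 i by rewrite /F => ->.
have Fgood i : good (F i) by rewrite /F; case: ifP.
have IC : [set: I] #<= [set: binseq].
  apply: binseq_prod; last exact: card_lexx.
  by apply: binseq_prod; [exact: binseq_count|exact: binseq_set].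
have [x xI xF] := evading_injection IC Fgood.
exists (range x); split => [a b ab||rho rhogood].
- have [p ap pb] := exists_rat_between ab.
  have [q pq qb] := exists_rat_between pb.
  pose i : I := (Some (p, q), set0, xpred0).
  exists (x i); first by exists i.
  (* [x i] is moved by its bump, hence lies between [p] and [q]. *)
  have := xF i i; rewrite FE; last by apply: bump_good; rewrite -(ltr_rat R).
  rewrite /F0 /= /bump; case: ifP => // /andP[pi iq] _.
  by rewrite (lt_trans ap pi) (lt_trans iq qb).
- rewrite card_eq_le; apply/andP; split.
    by apply: card_le_trans (card_leT _) (binseq_real R).
  apply/card_leTP; exists (fun c => x (None, set0, c)) => [c d /xI[]//|c].
  by exists (None, set0, c).
- move=> Ecount.
  have : continuum_le [set y | range x y /\ ~ range x (decode rho y)].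
    apply/card_leTP; exists (fun c => x (None, rho, c)) => [c d /xI[]//|c].
    split; first by exists (None, rho, c).
    by move=> [j _ /esym]; have := xF (None, rho, c) j; rewrite FE.
  move=> /card_le_trans /(_ Ecount) /card_leTP[f fI _].
  (* Cantor's diagonal argument against an injection of [binseq] into [nat]. *)
  pose diag n := `[< exists2 c, f c = n & ~~ c n >].
  have : diag (f diag) <-> ~~ diag (f diag).
    split => [/asboolP[c /fI -> //]|nd]; apply/asboolP; by exists diag.
  by case: (diag _) => -[]; [move=> /(_ isT)|move=> _ /(_ isT)].
Qed.

(** * Endomorphisms of dense chains *)

Lemma endomorphism_constant_on d (T : orderType d) (f : T -> T) (x y : T) :
  is_endomorphism f -> f x = f y -> constant_on f `[x, y].
Proof.
move=> fhomo fxy; suff fc z : `[x, y]%classic z -> f z = f x.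
  by move=> a b /fc -> /fc ->.
rewrite /= in_itv /= => /andP[xz zy]; apply/le_anti.
by rewrite (fhomo _ _ xz) fxy (fhomo _ _ zy).
Qed.

Section DenseChain.
Variables (d : Order.disp_t) (T : orderType d).
Hypothesis Tdense :
  forall u v : T, (u < v)%O -> exists2 w, (u < w)%O & (w < v)%O.

Lemma open_chain_itv (O : set (order_topology T)) :
  (forall u : T, exists2 v, (v < u)%O & exists w, (u < w)%O) ->
  O !=set0 -> open O ->
  exists u v : T, (u < v)%O /\ forall w, (u < w < v)%O -> O w.
Proof.
move=> Tunb [x Ox]; rewrite openE => /(_ _ Ox); rewrite /interior itv_nbhsE.
case=> -[a b] [ab_open xab abO]; have [l lx [r xr]] := Tunb x.
move: xab ab_open abO; rewrite in_itv.
have lr := lt_trans lx xr.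
case: a => [[] a|[]]; case: b => [[] b|[]] //=.
- move=> /andP[ax xb] _ abO; exists a, b.
  split=> [|w wab]; first exact: lt_trans xb.
  by apply: abO; rewrite /= in_itv.
- move=> /andP[ax _] _ abO; exists a, r.
  split=> [|w /andP[aw _]]; first exact: lt_trans xr.
  by apply: abO; rewrite /= in_itv /= aw.
- move=> xb _ abO; exists l, b.
  split=> [|w /andP[_ wb]]; first exact: lt_trans xb.
  by apply: abO; rewrite /= in_itv /= wb.
- by move=> _ _ abO; exists l, r; split=> // w _; apply: abO; rewrite /= in_itv.
Qed.

(** Equal values at [w] and [w'] make [f] constant between them, and density puts a point of [C_ f]
    there. *)
Lemma endomorphism_lt_in (f : T -> T) (u v : T) : is_endomorphism f ->
  (forall w, (u < w < v)%O -> ~ C_ f w) ->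
  forall w w', (u < w)%O -> (w < w')%O -> (w' < v)%O -> (f w < f w')%O.
Proof.
move=> fhomo nC w w' uw ww' w'v.
rewrite lt_neqAle fhomo ?(ltW ww')// andbT; apply/negP => /eqP fww'.
have [z wz zw'] := Tdense ww'.
apply: (nC z); first by rewrite (lt_trans uw wz) (lt_trans zw' w'v).
exists w, w'; split => //; left; apply: endomorphism_constant_on => //.
apply/le_anti; rewrite (fhomo _ _ (ltW wz)) fww'; apply: fhomo; exact: ltW.
Qed.

Hypothesis Tlic :
  forall f : T -> T, is_endomorphism f -> locally_identity_constant f.

Lemma trivial_Emb : trivial_monoid (Emb T).
Proof.
apply/seteqP; split => [f fmono|_ -> //]; apply/funext => z.
have fhomo : is_endomorphism f.
  by move=> u v; rewrite le_eqVlt => /orP[/eqP ->//|/fmono/ltW].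
have fix_between u v : (u < v)%O -> exists2 w, (u < w < v)%O & f w = w.
  move=> uv; have [w uw wv] := Tdense uv.
  have [||y [yuv [[a [b [ay yb fc]]]|fy]]] :=
      Tlic fhomo (O := `]u, v[%classic).
  - by exists w; rewrite /= in_itv /= uw.
  - exact: itv_open.
  - exfalso; case: fc => fc.
      have := fmono _ _ ay.
      by rewrite (fc a y) ?ltxx //= in_itv /= lexx (ltW ay).
    by have := fmono _ _ yb; rewrite (fc b y) ?ltxx //= in_itv /= lexx (ltW yb).
  - by exists y => //; move: yuv; rewrite /= in_itv.
(* A fixed point strictly between [z] and [f z] is on opposite sides of [z] and of [f z], against
   strict monotonicity. *)
have [fz|zf|//] := ltgtP (f z) z.
- have [w /andP[fw wz] wE] := fix_between _ _ fz.
  by have := fmono _ _ wz; rewrite wE => /(lt_trans fw); rewrite ltxx.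
- have [w /andP[zw wf] wE] := fix_between _ _ zf.
  by have := fmono _ _ zw; rewrite wE => /(lt_trans wf); rewrite ltxx.
Qed.

(* A right inverse of an epimorphism is an embedding. *)
Lemma trivial_Epi : trivial_monoid (Epi T).
Proof.
apply/seteqP; split => [f [fhomo fsurj]|_ ->]; last by split => // x; exists x.
have /choice[s sK] y : exists x, f x = y by have [x _] := fsurj y I; exists x.
suff sE : s = id by apply/funext => y; rewrite -{2}(sK y) sE.
have : Emb T s.
  by move=> x y; apply: contraTT; rewrite -!leNgt => /fhomo; rewrite !sK.
by rewrite trivial_Emb.
Qed.

End DenseChain.

(** * Endomorphisms of the evading set *)

Section Subchain.
Variables (R : realType) (X : set R).
Hypothesis Xdense : forall a b : R, a < b -> exists2 x, X x & a < x < b.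
Local Notation T := (subchain X).
Implicit Types (u v w : T) (f : T -> T).

Let lt_val u v : (u < v)%O = (val u < val v). Proof. by []. Qed.
Let le_val u v : (u <= v)%O = (val u <= val v). Proof. by []. Qed.

Let between (a b : R) : a < b -> exists2 u : T, a < val u & val u < b.
Proof.
move=> /Xdense[x Xx /andP[ax xb]].
by exists (SigSub (mem_set Xx) : T).
Qed.

Let X_val u : X (val u). Proof. exact: set_valP. Qed.

Lemma subchain_dense u v : (u < v)%O -> exists2 w : T, (u < w)%O & (w < v)%O.
Proof. exact: between. Qed.

Lemma subchain_unbounded u : exists2 v : T, (v < u)%O & exists w, (u < w)%O.
Proof.
have [v _ vu] : exists2 v : T, val u - 1 < val v & val v < val u.
  by apply: between; lra.
have [w uw _] : exists2 w : T, val u < val w & val w < val u + 1.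
  by apply: between; lra.
by exists v => //; exists w.
Qed.

(** [decode rho r] is the supremum of [f] over the points before [r]: a rational fits between such a
    point and [r], and rationals approximate its value from below. *)
Lemma endomorphism_decode f : is_endomorphism f -> exists rho,
  (forall u r, val u < r -> val (f u) <= decode rho r) /\
  (forall v r, r <= val v -> decode rho r <= val (f v)).
Proof.
move=> fhomo.
pose rho := [set pq : rat * rat |
  exists2 u : T, val u < ratr pq.1 & ratr pq.2 < val (f u)].
have ub v (r : R) : r <= val v ->
    ubound [set ratr q | q in [set q | exists2 p, ratr p < r & rho (p, q)]]
      (val (f v)).
  move=> rv _ [q [p pr [u up /= qfu]] <-]; apply: le_trans (ltW qfu) _.
  rewrite -le_val; apply: fhomo; rewrite le_val ltW //.
  exact: lt_le_trans (lt_trans up pr) rv.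
exists rho; split => [u r ur|v r rv].
- rewrite leNgt; apply/negP => /exists_rat_between[q].
  rewrite ltNge => /negP + qfu; apply.
  apply: ub_le_sup.
    (* A point beyond [r] bounds the set; without a bound [sup] would take a default value. *)
    have [v rv _] : exists2 v : T, r < val v & val v < r + 1.
      by apply: between; lra.
    by exists (val (f v)); apply: ub; exact: ltW.
  have [p up pr] := exists_rat_between ur.
  by exists q => //; exists p => //; exists u.
- apply: ge_sup; last exact: ub.
  have [u _ ur] : exists2 u : T, r - 1 < val u & val u < r.
    by apply: between; lra.
  have [p up pr] := exists_rat_between ur.
  have [q _ qfu] : exists2 q : rat, val (f u) - 1 < ratr q & ratr q < val (f u).
    by apply: exists_rat_between; lra.
  by exists (ratr q), q => //; exists p => //; exists u.
Qed.

Hypothesis Xevading : forall rho,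
  continuum_le (decode rho @` [set r : R | decode rho r <> r]) ->
  ~ countable [set x : R | X x /\ ~ X (decode rho x)].

Lemma endomorphism_locally_identity_constant f :
  is_endomorphism f -> locally_identity_constant f.
Proof.
move=> fhomo; rewrite /locally_identity_constant => O O0 Oopen.
have [u [v [uv uvO]]] := open_chain_itv subchain_unbounded O0 Oopen.
apply: contrapT => nO.
have nCI w : (u < w < v)%O -> ~ C_ f w /\ f w <> w.
  move=> /uvO Ow.
  by split=> [Cw|Iw]; apply: nO; exists w; split=> //; [left|right].
have [rho [rhoge rhole]] := endomorphism_decode fhomo.
have fmono := endomorphism_lt_in subchain_dense fhomo
  (fun w uwv => proj1 (nCI w uwv)).
(* Two points [w < w'] of [X] between [r] and [r'] separate the left limits. *)
have dmono r r' : val u < r -> r < r' -> r' < val v ->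
    decode rho r < decode rho r'.
  move=> ur rr' r'v.
  have [w' rw' w'r'] := between rr'.
  have [w rw ww'] := between rw'.
  apply: le_lt_trans (rhole w r (ltW rw)) _.
  apply: lt_le_trans (rhoge w' r' w'r').
  by apply: fmono; rewrite ?lt_val //; [exact: lt_trans rw|exact: lt_trans r'v].
(* If [f x < x], the left limit stays at most [f x] before [x], so it has no fixed point just below
   [x]; if [x < f x], argue just above [x]. *)
have [a [b [ab ua bv dfix]]] : exists a b, [/\ a < b, val u <= a, b <= val v &
    forall r, a < r < b -> decode rho r <> r].
  have [x ux xv] := subchain_dense uv.
  have [|_ /eqP] := nCI x; first by rewrite ux.
  rewrite neq_lt !lt_val => /orP[fx|xf].
    exists (Num.max (val u) (val (f x))), (val x).
    rewrite gt_max le_max lexx fx ; split => //; first by rewrite andbT.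
      exact: ltW.
    move=> r; rewrite gt_max => /andP[/andP[_ fxr] rx] drr.
    by have := rhole x r (ltW rx); rewrite drr leNgt fxr.
  exists (val x), (Num.min (val v) (val (f x))).
  rewrite lt_min ge_min lexx xf; split => //; first by rewrite andbT.
    exact: ltW.
  move=> r; rewrite lt_min => /andP[xr /andP[_ rfx]] drr.
  by have := rhoge x r xr; rewrite drr leNgt rfx.
apply: (Xevading (rho := rho)).
  (* On []a, b[] the left limit is injective and moves every point. *)
  have /card_leTP[h hI hA] := continuum_le_itvoo ab.
  have h_itv c : a < h c < b by have := hA c; rewrite /= in_itv.
  apply/card_leTP; exists (decode rho \o h) => [c d /= cd|c]; last first.
    by exists (h c) => //; apply: dfix.
  apply: hI; have /andP[ac cb] := h_itv c; have /andP[ad db] := h_itv d.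
  have [cd'|cd'|//] := ltgtP (h c) (h d).
  - have := dmono _ _ (le_lt_trans ua ac) cd' (lt_le_trans db bv).
    by rewrite cd ltxx.
  - have := dmono _ _ (le_lt_trans ua ad) cd' (lt_le_trans cb bv).
    by rewrite cd ltxx.
(* A jump of [f] at [x] is recorded by a rational strictly inside it. *)
have /choice[q qP] (x : R) : exists q : rat, forall w, val w = x ->
    ~ X (decode rho x) -> decode rho x < ratr q < val (f w).
  have [[w [wx nX]]|nw] := pselect (exists w, val w = x /\ ~ X (decode rho x)).
    (* [f w] lies in [X] and the left limit does not, so the jump is proper. *)
    have : decode rho x < val (f w).
      rewrite lt_neqAle rhole ?wx // andbT.
      apply/eqP => E; apply: nX; rewrite E.
      exact: X_val.
    move=> /exists_rat_between[q xq qw]; exists q => w' w'x _.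
    by rewrite (val_inj (etrans w'x (esym wx))) xq.
  by exists 0%R => w wx nX; case: nw; exists w.
(* The jump at [x] ends at [f x], which is at most the left limit at [y], where the next jump
   starts. *)
have qmono x y : X x -> X y -> ~ X (decode rho x) -> ~ X (decode rho y) ->
    x < y -> (q x < q y)%R.
  move=> Xx Xy nXx nXy xy.
  have /andP[_ qx] := qP x (SigSub (mem_set Xx) : T) erefl nXx.
  have /andP[qy _] := qP y (SigSub (mem_set Xy) : T) erefl nXy.
  by rewrite -(ltr_rat R); apply: lt_trans qx (le_lt_trans (rhoge _ _ _) qy).
have : [set x | X x /\ ~ X (decode rho x)] #<= [set: rat].
  apply/pcard_injP; exists q => x y; rewrite !inE => -[Xx nXx] [Xy nXy] qxy.
  have [xy|yx|//] := ltgtP x y.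
    by have := qmono _ _ Xx Xy nXx nXy xy; rewrite qxy ltxx.
  by have := qmono _ _ Xy Xx nXy nXx yx; rewrite qxy ltxx.
by move=> /card_le_trans; apply; exact: countableP.
Qed.

End Subchain.

Theorem theorem3p3 (R : realType) :
  exists X : set R,
    [/\ dense X,
        X #= [set: nat -> bool],
        trivial_monoid (Emb (subchain X)),
        trivial_monoid (Epi (subchain X)) &
        forall f : subchain X -> subchain X,
          is_endomorphism f -> locally_identity_constant f].
Proof.
have [X [Xdense Xcard Xevading]] := exists_evading_set R.
have Xlic := endomorphism_locally_identity_constant Xdense Xevading.
have sdense := subchain_dense Xdense.
exists X.
split; [|exact: Xcard|exact: trivial_Emb|exact: trivial_Epi|exact: Xlic].
move=> O [x Ox]; rewrite openE => /(_ _ Ox) /nbhs_ballP[e /= e0 xeO].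
have [|y Xy /andP[xy yxe]] := Xdense x (x + e); first by rewrite ltrDl.
exists y; split => //; apply: xeO.
by rewrite /ball /= distrC ger0_norm ?subr_ge0 ?ltW// ltrBlDl.
Qed.
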